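(* Consider the observation process $$Y_t=\alpha(t)X+\sigma B_t .$$ In the case $\frac{\alpha(t)}{\sigma\sqrt{t}}\to+\infty$ as $t\to+\infty$, for arbitrary $\zeta>0$ and $\varepsilon>0$ there is a $T=T(\zeta,\varepsilon)$ large enough such that for all $t\ge T$ the observation process satisfies $$\mathbb{P}\left(|Y_t|\ge\zeta\right)\ge 1-\varepsilon .$$
   Context: Here $N\ge 1$, and $X$ is a random vector with law $\nu$ on $\{-1,1\}^N$, where $\nu(x)\propto e^{-\frac{\beta}{2}\langle x,Wx\rangle+\langle x,b\rangle}$ with $W$ a real $N\times N$ matrix, $b\in\mathbb{R}^N$, $\beta>0$ the inverse temperature and $\langle\cdot,\cdot\rangle$ the standard inner product on $\mathbb{R}^N$. The process $(B_t)_{t\ge 0}$ is a standard Brownian motion in $\mathbb{R}^N$ independent of $X$, $\sigma>0$ is a constant, and $\alpha$ is a real-valued function of time $t\in[0,\infty)$. The symbol $|\cdot|$ denotes the Euclidean norm on $\mathbb{R}^N$, which is the absolute value when $N=1$. *)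

(* Defs.v *)
From mathcomp Require Import all_boot all_order all_algebra.
From mathcomp Require Import finmap.
From mathcomp Require Import all_classical all_reals all_analysis.

Set Implicit Arguments.
Unset Strict Implicit.
Unset Printing Implicit Defensive.

Import Order.TTheory GRing.Theory Num.Theory.
Import numFieldTopology.Exports numFieldNormedType.Exports.

Local Open Scope classical_set_scope.
Local Open Scope ring_scope.

Section euclidean.
Context {R : realType} {N : nat}.
Implicit Types u v : 'cV[R]_N.

Definition inner u v : R := \sum_(i < N) u i ord0 * v i ord0.

(* The norm `|v| of the library on matrices is the sup norm. *)
Definition enorm v : R := Num.sqrt (inner v v).

End euclidean.

Section gibbs.
Context {R : realType} {N : nat}.

Definition spin (s : {ffun 'I_N -> bool}) : 'cV[R]_N :=
  \col_i (if s i then 1 else -1).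

Variables (W : 'M[R]_N) (b : 'cV[R]_N) (beta : R).

Definition gibbs_weight (x : 'cV[R]_N) : R :=
  expR (- (beta / 2) * inner x (W *m x) + inner x b).

Definition gibbs_Z : R :=
  \sum_(s : {ffun 'I_N -> bool}) gibbs_weight (spin s).

Definition gibbs (s : {ffun 'I_N -> bool}) : R :=
  gibbs_weight (spin s) / gibbs_Z.

End gibbs.

Section independence.
Context {d : measure_display} {Omega : measurableType d} {R : realType}.

(* The sigma-algebra generated by the variables Z i, for i in D. *)
Definition sigma_of (I : Type) (D : set I) (Z : I -> Omega -> R) :
    set (set Omega) :=
  <<s \bigcup_(i in D) preimage_set_system setT (Z i) measurable >>.

Variable P : probability Omega R.

Definition independent (F G : set (set Omega)) :=
  forall A B, F A -> G B -> P (A `&` B) = (P A * P B)%E.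

Definition mutually_independent (I : choiceType)
    (F : I -> set (set Omega)) :=
  forall (J : {fset I}) (A : I -> set Omega),
    (forall i, i \in J -> F i (A i)) ->
    P (\bigcap_(i in [set` J]) A i) = (\prod_(i <- J) P (A i))%E.

End independence.

Section random_objects.
Context {d : measure_display} {Omega : measurableType d} {R : realType}.
Variable P : probability Omega R.

Definition random_vector (N : nat) (X : Omega -> 'cV[R]_N) :=
  forall i, measurable_fun [set: Omega] (fun w => X w i ord0).

(* The point masses add up to 1, so X lies in {-1,1}^N almost surely. *)
Definition has_gibbs_law (N : nat) (W : 'M[R]_N) (b : 'cV[R]_N) (beta : R)
    (X : Omega -> 'cV[R]_N) :=
  random_vector X /\
  forall s, P [set w | X w = spin s] = (gibbs W b beta s)%:E.

(* Processes are indexed by R, but only their values at times t >= 0 are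
   constrained. *)
Record brownian_motion1 (B : R -> Omega -> R) : Prop := BrownianMotion1 {
  bm1_measurable : forall t, 0 <= t -> measurable_fun [set: Omega] (B t) ;
  bm1_start : {ae P, forall w, B 0 w = 0} ;
  bm1_continuous : {ae P, forall w, {within `[0, +oo[, continuous (B ^~ w)}} ;
  bm1_independent_increments : forall (n : nat) (t : nat -> R),
    0 <= t 0%N -> (forall k, (k < n)%N -> t k <= t k.+1) ->
    mutually_independent P (fun k : 'I_n =>
      preimage_set_system setT (fun w => B (t k.+1) w - B (t k) w) measurable) ;
  (* The second parameter of normal_prob is the standard deviation. *)
  bm1_gaussian_increments : forall s t, 0 <= s -> s < t ->
    forall U, measurable U ->
    P [set w | U (B t w - B s w)] = normal_prob 0 (Num.sqrt (t - s)) U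
}.

Record brownian_motion (N : nat) (B : R -> Omega -> 'cV[R]_N) : Prop :=
  BrownianMotion {
    bm_coord : forall i, brownian_motion1 (fun t w => B t w i ord0) ;
    bm_independent_coords : mutually_independent P (fun i : 'I_N =>
      sigma_of [set t | 0 <= t] (fun t w => B t w i ord0))
  }.

Definition independent_vector_process (N : nat)
    (X : Omega -> 'cV[R]_N) (B : R -> Omega -> 'cV[R]_N) :=
  independent P
    (sigma_of [set: 'I_N] (fun i w => X w i ord0))
    (sigma_of [set p : R * 'I_N | 0 <= p.1] (fun p w => B p.1 w p.2 ord0)).

Definition observation (N : nat) (alpha : R -> R) (sigma : R)
    (X : Omega -> 'cV[R]_N) (B : R -> Omega -> 'cV[R]_N)
    (t : R) (w : Omega) : 'cV[R]_N :=
  alpha t *: X w + sigma *: B t w.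

End random_objects.

(* Main.v *)
Require Import Defs.
From mathcomp Require Import all_boot all_order all_algebra.
From mathcomp Require Import all_classical all_reals all_analysis.
From mathcomp Require Import measurable_realfun lra.

Import Order.TTheory GRing.Theory Num.Theory.
Import numFieldTopology.Exports numFieldNormedType.Exports.

Local Open Scope classical_set_scope.
Local Open Scope ring_scope.

(** The spreading of the Gaussian noise already drives the observation out of
every fixed ball, uniformly in the position of the signal.

Fix one coordinate [i].  Almost surely [X i] is 1 or -1 and [B 0 i] is 0, so
[|Y_t| < zeta] forces [|c + sigma * (B t i - B 0 i)| < zeta] for [c = alpha t]
or for [c = - alpha t].  Each of these two events confines a centred Gaussian
variable of standard deviation [sqrt t] to an interval of length
[2 * zeta / sigma].  A Gaussian density never exceeds the inverse of its
standard deviation, so, wherever that interval is located, its probability is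
at most [2 * zeta / (sigma * sqrt t)] ([normal_prob_itv_le],
[brownian_small_ball]).  The union bound over the two signs gives
[P (|Y_t| < zeta) <= 4 * zeta / (sigma * sqrt t)], which is at most [eps] as
soon as [t] reaches [(4 * zeta / (sigma * eps)) ^+ 2].

Two facts make the almost sure reduction legitimate: the Gibbs weights add up
to 1, so the law of [X] charges only spin vectors ([gibbs_law_ae_spin]), and
an inclusion of events up to a null set still compares their probabilities
([le_measure_ae]). *)

Set Implicit Arguments.
Unset Strict Implicit.

(** It reduces the problem in dimension [N] to a single coordinate: a small
vector has a small coordinate. *)
Lemma ler_abs_enorm (R : realType) (N : nat) (v : 'cV[R]_N) (i : 'I_N) :
  `|v i ord0| <= enorm v.
Proof.
rewrite /enorm /inner -sqrtr_sqr ler_sqrt; last first.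
  by apply: sumr_ge0 => j _; rewrite -expr2 sqr_ge0.
rewrite (bigD1 i)//= -expr2 lerDl.
by apply: sumr_ge0 => j _; rewrite -expr2 sqr_ge0.
Qed.

Lemma measurable_enorm (R : realType) (d : measure_display)
    (Omega : measurableType d) (N : nat) (V : Omega -> 'cV[R]_N) :
  random_vector V -> measurable_fun [set: Omega] (fun w => enorm (V w)).
Proof.
move=> mV; rewrite /enorm /inner.
apply: (measurableT_comp (continuous_measurable_fun (@sqrt_continuous R))).
by apply: measurable_sum => i; exact: measurable_funM.
Qed.

Lemma le_measure_ae (R : realType) (d : measure_display)
    (Omega : measurableType d) (mu : {measure set Omega -> \bar R})
    (A C : set Omega) :
  measurable A -> measurable C ->
  {ae mu, forall w, A w -> C w} -> (mu A <= mu C)%E.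
Proof.
move=> mA mC [Z [mZ Z0 AZ]].
rewrite -(measureU0 mC mZ Z0) le_measure ?inE//; first exact: measurableU.
move=> w Aw; have [Cw|nCw] := pselect (C w); [by left|right].
by apply: AZ => /= AtoC; exact/nCw/AtoC.
Qed.

(** The density is bounded by its value at the mean, so the normal law is
dominated by a multiple of Lebesgue measure. *)
Lemma normal_prob_le_peak (R : realType) (m s : R) (V : set R) :
  s != 0 -> measurable V ->
  (normal_prob m s V <= (normal_peak s)%:E * lebesgue_measure V)%E.
Proof.
move=> s0 mV; rewrite /normal_prob -integral_cst//.
apply: ge0_le_integral => //=.
- by move=> x _; rewrite lee_fin normal_pdf_ge0.
- by apply/measurable_funTS/measurable_EFinP; exact: measurable_normal_pdf.
- by move=> x _; rewrite lee_fin normal_pdf_ub.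
Qed.

(** The factor [1 / sqrt (2 * pi)] is dropped: a cruder constant is enough,
and it keeps the threshold on the time free of [pi]. *)
Lemma normal_peak_le_inv (R : realType) (s : R) :
  0 < s -> normal_peak s <= s^-1.
Proof.
move=> s0; rewrite /normal_peak lef_pV2 ?posrE//; last first.
  by rewrite sqrtr_gt0 mulrn_wgt0// mulr_gt0 ?pi_gt0// exprn_gt0.
rewrite -{1}(gtr0_norm s0) -sqrtr_sqr ler_wsqrtr//.
have := @pi_ge2 R; have : 0 < s ^+ 2 by rewrite exprn_gt0.
nra.
Qed.

(** Anti-concentration: the bound depends on the length of the interval and
not on its distance to the mean, hence it is insensitive to translations of
the variable. *)
Lemma normal_prob_itv_le (R : realType) (m s a c : R) :
  0 < s -> a <= c -> (normal_prob m s `]a, c[%classic <= ((c - a) / s)%:E)%E.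
Proof.
move=> s0 ac; apply: le_trans (normal_prob_le_peak _ _ _) _ => //.
  by rewrite gt_eqF.
rewrite lebesgue_measure_itv/=.
have -> : (if (a%:E < c%:E)%E then c%:E - a%:E else 0)%E = (c - a)%:E.
  rewrite lte_fin; case: ltP => [_|ca]; first by rewrite EFinB.
  by rewrite (@le_anti _ _ a c) ?ac ?ca// subrr.
by rewrite -EFinM lee_fin mulrC ler_wpM2l ?subr_ge0// normal_peak_le_inv.
Qed.

Section spins.
Context {R : realType} {N : nat}.

Lemma spin_inj : injective (@spin R N).
Proof.
move=> s s' ss'; apply/ffunP => i.
have /(congr1 (fun v : 'cV[R]_N => v i ord0)) := ss'.
by rewrite !mxE; case: (s i); case: (s' i) => //; lra.
Qed.

Lemma spin_pm1 (s : {ffun 'I_N -> bool}) (i : 'I_N) :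
  spin s i ord0 = 1 :> R \/ spin s i ord0 = -1 :> R.
Proof. by rewrite mxE; case: (s i); [left|right]. Qed.

Lemma gibbs_sum1 (W : 'M[R]_N) (b : 'cV[R]_N) (beta : R) :
  \sum_s gibbs W b beta s = 1.
Proof.
rewrite /gibbs -mulr_suml divff// gt_eqF//.
rewrite /gibbs_Z (bigD1 [ffun=> true])//= ltr_pwDl ?expR_gt0//.
by apply: sumr_ge0 => s _; exact: expR_ge0.
Qed.

End spins.

Lemma measurable_vector_eq (R : realType) (d : measure_display)
    (Omega : measurableType d) (N : nat) (V : Omega -> 'cV[R]_N) (v : 'cV[R]_N) :
  random_vector V -> measurable [set w | V w = v].
Proof.
move=> mV.
have -> : [set w | V w = v] =
    \bigcap_(i in [set: 'I_N]) ((fun w => V w i ord0) @^-1` [set v i ord0]).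
  apply/seteqP; split=> [w /= <- i _ //|w /= Vv].
  by apply/matrixP => i j; rewrite (ord1 j); exact: Vv.
apply: fin_bigcap_measurable => // i _.
by rewrite -[X in measurable X]setTI; apply: mV.
Qed.

(** The events [X = spin s] are disjoint and their probabilities, the Gibbs
weights, have total mass 1; their union therefore has a null complement. *)
Lemma gibbs_law_ae_spin (R : realType) (d : measure_display)
    (Omega : measurableType d) (P : probability Omega R) (N : nat)
    (W : 'M[R]_N) (b : 'cV[R]_N) (beta : R) (X : Omega -> 'cV[R]_N) :
  has_gibbs_law P W b beta X -> {ae P, forall w, exists s, X w = spin s}.
Proof.
move=> [mX lawX].
pose E (s : {ffun 'I_N -> bool}) := [set w | X w = spin s].
have mE s : measurable (E s) by exact: measurable_vector_eq.
have mU : measurable (\bigcup_(s in [set: {ffun 'I_N -> bool}]) E s).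
  exact: fin_bigcup_measurable.
have PU : P (\bigcup_(s in [set: {ffun 'I_N -> bool}]) E s) = 1%E.
  rewrite measure_fin_bigcup//; [|exact: finite_finset|]; last first.
    by move=> s s' _ _ [w [/= Xs Xs']]; apply: (@spin_inj R N); rewrite -Xs -Xs'.
  rewrite (fsbigE (index_enum {ffun 'I_N -> bool})) ?index_enum_uniq//; last first.
    by move=> s _; rewrite mem_index_enum.
  rewrite -(gibbs_sum1 W b beta) -sumEFin.
  by apply: eq_big => s; [rewrite mem_set|move=> _; exact: lawX].
exists (~` \bigcup_(s in [set: {ffun 'I_N -> bool}]) E s); split.
- exact: measurableC.
- by rewrite [LHS]probability_setC// PU subee.
- by apply: subsetC => w [s _ Xs]; exists s.
Qed.

(** The shift [c] stands for the signal and is arbitrary.  The increment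
[B t - B 0] is used in place of [B t], since its law is the one given by the
definition of Brownian motion. *)
Lemma brownian_small_ball (R : realType) (d : measure_display)
    (Omega : measurableType d) (P : probability Omega R)
    (B : R -> Omega -> R) (hB : brownian_motion1 P B) (sigma c r t : R) :
  0 < sigma -> 0 < t -> 0 <= r ->
  (P [set w | (`|c + sigma * (B t w - B 0 w)| < r)%R] <=
    (2 * r / (sigma * Num.sqrt t))%:E)%E.
Proof.
move=> s0 t0 r0.
have -> : [set w | `|c + sigma * (B t w - B 0 w)| < r] =
    [set w | `](- r - c) / sigma, (r - c) / sigma[%classic (B t w - B 0 w)].
  apply/seteqP; split=> w /=; rewrite in_itv/= ltr_norml ltr_pdivrMr// ltr_pdivlMr//;
    by move=> /andP[? ?]; apply/andP; split; lra.
rewrite (bm1_gaussian_increments hB)// subr0.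
apply: le_trans (normal_prob_itv_le _ _ _) _; first by rewrite sqrtr_gt0.
  by rewrite ler_pM2r ?invr_gt0//; lra.
rewrite lee_fin -mulrBl invfM mulrA.
by have -> : r - c - (- r - c) = 2 * r by lra.
Qed.

Lemma measurable_small_ball (R : realType) (d : measure_display)
    (Omega : measurableType d) (f : Omega -> R) (r : R) :
  measurable_fun [set: Omega] f -> measurable [set w | `|f w| < r].
Proof.
move=> mf; rewrite -[X in measurable X]setTI.
by apply: measurable_fun_ltr => //; exact: measurableT_comp.
Qed.

Unset Implicit Arguments.

Theorem theorem3p1 (R : realType) (d : measure_display)
  (Omega : measurableType d) (P : probability Omega R)
  (N : nat) (hN : (1 <= N)%N)
  (W : 'M[R]_N) (b : 'cV[R]_N) (beta : R) (hbeta : 0 < beta)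
  (X : Omega -> 'cV[R]_N) (hX : has_gibbs_law P W b beta X)
  (B : R -> Omega -> 'cV[R]_N) (hB : brownian_motion P B)
  (hXB : independent_vector_process P X B)
  (sigma : R) (hsigma : 0 < sigma) (alpha : R -> R)
  (halpha : alpha t / (sigma * Num.sqrt t) @[t --> +oo%R] --> +oo%R) :
  forall zeta eps : R, 0 < zeta -> 0 < eps ->
  exists2 T : R, 0 <= T &
    forall t : R, T <= t ->
      ((1 - eps)%:E <=
        P [set w | (zeta <= enorm (observation alpha sigma X B t w))%R])%E.
Proof.
move=> zeta eps z0 e0.
have r0 : 0 < 4 * zeta / (sigma * eps) by rewrite divr_gt0 ?mulr_gt0.
exists ((4 * zeta / (sigma * eps)) ^+ 2); first exact: sqr_ge0.
move=> t Tt.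
have t0 : 0 < t by apply: lt_le_trans Tt; rewrite exprn_gt0.
pose i := Ordinal hN.
have hBi := bm_coord hB i.
pose far := [set w | zeta <= enorm (observation alpha sigma X B t w)].
pose near c := [set w | `|c + sigma * (B t w i ord0 - B 0 w i ord0)| < zeta].
have mfar : measurable far.
  rewrite -[far]setTI; apply: measurable_fun_ler => //.
  apply: measurable_enorm => j.
  rewrite (_ : (fun _ => _) = fun w => alpha t * X w j ord0 + sigma * B t w j ord0).
    apply: measurable_funD; apply: measurable_funM => //; first exact: hX.1.
    exact: (bm1_measurable (bm_coord hB j) (ltW t0)).
  by apply/funext => w; rewrite !mxE.
have mnear c : measurable (near c).
  apply: measurable_small_ball; apply: measurable_funD => //.
  apply: measurable_funM => //; apply: measurable_funB.
    exact: (bm1_measurable hBi (ltW t0)).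
  exact: (bm1_measurable hBi (lexx 0)).
have nearP c : (P (near c) <= (eps / 2)%:E)%E.
  apply: le_trans (brownian_small_ball hBi _ _ _ _) _ => //.
    exact: ltW.
  (* Each of the two signs receives half of [eps]; this is where the value of
     the threshold comes from. *)
  have : 4 * zeta / (sigma * eps) <= Num.sqrt t.
    by rewrite -(ger0_norm (ltW r0)) -sqrtr_sqr ler_wsqrtr.
  rewrite lee_fin !ler_pdivrMr ?mulr_gt0 ?sqrtr_gt0//.
  by move=> ?; nra.
have Pclose : (P (~` far) <= eps%:E)%E.
  have -> : eps%:E = ((eps / 2)%:E + (eps / 2)%:E)%E by rewrite -EFinD -splitr.
  apply: (@le_trans _ _ (P (near (alpha t) `|` near (- alpha t)))); last first.
    apply: le_trans (measureU2 _ (mnear _) (mnear _)) _.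
    by apply: leeD; exact: nearP.
  apply: le_measure_ae; [exact: measurableC|exact: measurableU|].
  move: (gibbs_law_ae_spin hX) (bm1_start hBi).
  apply: filterS2 => w [s Xs] B0 /negP; rewrite -ltNge => Yz.
  have := le_lt_trans (ler_abs_enorm _ i) Yz.
  rewrite !mxE Xs /near /= B0 subr0.
  by have [->|->] := @spin_pm1 R N s i; rewrite ?mulr1 ?mulrN1; [left|right].
rewrite -/far -[X in P X](setCK far) probability_setC ?EFinB; last exact: measurableC.
by rewrite leeB.
Qed.
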